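(* Let $R$ be a ring with identity and let $a,w,b,c,s,t\in R$ be such that the $(t,c)$-inverse $a^{(t,c)}$ of $a$ and the $(b,s)$-inverse $w^{(b,s)}$ of $w$ exist. Then the following statements are equivalent: (i) $aw$ is $(b,c)$-invertible and $(aw)^{(b,c)}=w^{(b,s)}a^{(t,c)}$; (ii) $b=w^{(b,s)}a^{(t,c)}awb$ and $c=caww^{(b,s)}a^{(t,c)}$.
   Context: Rings are associative with identity, not necessarily commutative. For $b,c\in R$, an element $a\in R$ is called $(b,c)$-invertible if there exists $y\in R$ such that $y\in (bRy)\cap (yRc)$, $yab=b$ and $cay=c$. Such a $y$ is unique when it exists; it is called the $(b,c)$-inverse of $a$ and denoted $a^{(b,c)}$. *)

(* Defs.v *)
From mathcomp Require Import all_boot all_algebra.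
From mathcomp Require Import boolp classical_sets.

Set Implicit Arguments.
Unset Strict Implicit.
Unset Printing Implicit Defensive.

Import GRing.Theory.
Local Open Scope ring_scope.

(* The first two clauses say that y lies in bRy and in yRc. *)
Definition is_bc_inverse (R : pzRingType) (b c a y : R) : Prop :=
  [/\ exists r : R, y = b * r * y,
      exists r : R, y = y * r * c,
      y * a * b = b &
      c * a * y = c].

Definition bc_invertible (R : pzRingType) (b c a : R) : Prop :=
  exists y : R, is_bc_inverse b c a y.

(* Total by convention: the value is 0 when a is not (b,c)-invertible. *)
Definition bc_inverse (R : pzRingType) (b c a : R) : R :=
  xget 0 [set y : R | is_bc_inverse b c a y]%classic.

Lemma is_bc_inverse_uniq (R : pzRingType) (b c a y z : R) :
  is_bc_inverse b c a y -> is_bc_inverse b c a z -> y = z.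
Proof.
move=> [[r yE] _ _ cay] [_ [r' zE] zab _].
have -> : y = z * a * y by rewrite {2}yE !mulrA zab -yE.
by rewrite {1}zE -(mulrA _ c) -mulrA cay -zE.
Qed.

Lemma bc_inverseP (R : pzRingType) (b c a : R) :
  bc_invertible b c a -> is_bc_inverse b c a (bc_inverse b c a).
Proof. by move=> [y ya]; exact: (xgetI 0 ya). Qed.

Lemma bc_inverseE (R : pzRingType) (b c a y : R) :
  is_bc_inverse b c a y -> bc_inverse b c a = y.
Proof.
by move=> ya; apply: is_bc_inverse_uniq (ya); apply: bc_inverseP; exists y.
Qed.

(* Main.v *)
Require Import Defs.
From mathcomp Require Import all_boot all_algebra.

Local Open Scope ring_scope.

(** Let [y] be the product of the two given inverses. Its left factor w' lies in bRw' and its right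
    factor a' in a'Rc, so [y] lies in bRy and yRc automatically. Only the two equations of (ii)
    remain for [y] to be a (b,c)-inverse of [a * w]. *)

Theorem theorem2p3 (R : pzRingType) (a w b c s t : R)
    (ha : bc_invertible t c a) (hw : bc_invertible b s w) :
  (bc_invertible b c (a * w) /\
   bc_inverse b c (a * w) = bc_inverse b s w * bc_inverse t c a)
  <->
  (b = bc_inverse b s w * bc_inverse t c a * a * w * b /\
   c = c * a * w * bc_inverse b s w * bc_inverse t c a).
Proof.
have [_ [ra aE] _ _] := bc_inverseP ha.
have [[rw wE] _ _ _] := bc_inverseP hw.
split=> [[haw yE] | [bE cE]].
  have [_ _ yab cay] := bc_inverseP haw.
  by split; [rewrite -{1}yab | rewrite -{1}cay]; rewrite yE !GRing.mulrA.
have y_inv : is_bc_inverse b c (a * w) (bc_inverse b s w * bc_inverse t c a).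
  split.
  (* The witnesses for the factors serve unchanged for the product. *)
  - by exists rw; rewrite {1}wE !GRing.mulrA.
  - by exists ra; rewrite {1}aE !GRing.mulrA.
  - by rewrite !GRing.mulrA -bE.
  - by rewrite !GRing.mulrA -cE.
split; first by exists (bc_inverse b s w * bc_inverse t c a).
(* By uniqueness, the chosen inverse is this product. *)
exact: bc_inverseE y_inv.
Qed.
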